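(* Let $F$ be a commutative field, $n\ge 2$ and $n'=\binom{n+2}{2}-1$. If $\nu$ is a regular quadratic embedding of $\mathrm{PG}(n,F)$ into $\mathrm{PG}(n',F)$ and $\rho$ denotes the quadratic Veronese embedding of $\mathrm{PG}(n,F)$ into $\mathrm{PG}(n',F)$, then there exists a collineation $\kappa$ of $\mathrm{PG}(n',F)$ such that $\nu=\rho\kappa$ (i.e. $X^\nu=(X^\rho)^\kappa$ for every point $X$ of $\mathrm{PG}(n,F)$).
   Context: $F$ is a commutative field. $\mathrm{PG}(n,F)=(\mathcal P,\mathcal L)$ and $\mathrm{PG}(n',F)=(\mathcal P',\mathcal L')$ are the projective spaces of projective dimension $n$, $n'$ over $F$, with point sets $\mathcal P,\mathcal P'$ and line sets $\mathcal L,\mathcal L'$. The symbol $\subset$ allows equality. A quadric of $\mathrm{PG}(n,F)$ is the set of zeros in $\mathcal P$ of a non-zero quadratic form on $F^{n+1}$. Let $\Phi=\{\mathcal S\subset\mathcal P \mid \mathcal S \text{ is a quadric of } \mathrm{PG}(n,F)\}\cup\{\mathcal P\}$. For $\mathcal M\subset\mathcal P$ the quadratic closure is $\overline{\overline{\mathcal M}}=\bigcap_{\mathcal M\subset\mathcal S,\ \mathcal S\in\Phi}\mathcal S$. For a set $\mathcal X$ of points of a projective space, $\overline{\mathcal X}$ denotes its linear closure (the smallest subspace containing it). Maps are written as right exponents (composition from left to right): $\mathcal M^\nu$ is the image of $\mathcal M$ and $(\cdot)^{\nu^{-1}}$ is the preimage. A map $\nu:\mathcal P\to\mathcal P'$ is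 a quadratic embedding of $\mathrm{PG}(n,F)$ into $\mathrm{PG}(n',F)$ if $\overline{\overline{\mathcal M}}=(\overline{\mathcal M^\nu})^{\nu^{-1}}$ for all $\mathcal M\subset\mathcal P$, and $\overline{\operatorname{im}\nu}=\mathcal P'$. For every line $\ell$ of $\mathrm{PG}(n,F)$, $\ell^\nu$ is then an arc (no three collinear points) spanning a plane $\overline{\ell^\nu}$. For an incident point-line pair $(P,\ell)$ of $\mathrm{PG}(n,F)$, $\nu$ is called $(P,\ell)$-regular if there is exactly one line in the plane $\overline{\ell^\nu}$ that runs through $P^\nu$ and is a unisecant of $\ell^\nu$ (i.e. meets $\ell^\nu$ only in $P^\nu$). If $\nu$ is $(P,\ell)$-regular for all incident pairs $(P,\ell)$, then $\nu$ is called regular. The quadratic Veronese embedding $\rho$ is $F(x_0,\ldots,x_n)\mapsto F(y_{ij})_{0\le i\le j\le n}$ with $y_{ij}=x_ix_j$. A collineation is a bijection on points that maps lines onto lines (not necessarily projective). *)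

(* Defs.v *)
From mathcomp Require Import all_boot all_algebra.
From mathcomp Require Import boolp classical_sets.
Set Implicit Arguments.
Unset Strict Implicit.
Unset Printing Implicit Defensive.
Import GRing.Theory.
Local Open Scope classical_set_scope.
Local Open Scope ring_scope.

(* Points of PG(n, F) are the vector lines of F^(n+1). *)
Definition pg (n : nat) (F : fieldType) : Type :=
  {U : {vspace 'rV[F]_n.+1} | \dim U == 1%N}.

Section ProjectiveSpace.
Variables (n : nat) (F : fieldType).
Local Notation point := (pg n F).
Local Notation vec := 'rV[F]_n.+1.

Lemma pg_vec_subproof (x : vec) : x != 0 -> \dim <[x]>%VS == 1%N.
Proof. by rewrite dim_vline => ->. Qed.

Definition pg_vec (x : vec) (nz_x : x != 0) : point :=
  exist _ <[x]>%VS (pg_vec_subproof nz_x).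

Definition pg_points (W : {vspace vec}) : set point :=
  [set P : point | (sval P <= W)%VS].

Definition is_subspace (S : set point) : Prop :=
  exists W : {vspace vec}, S = pg_points W.

Definition is_line (l : set point) : Prop :=
  exists2 W : {vspace vec}, \dim W = 2%N & l = pg_points W.

Definition lin_closure (M : set point) : set point := smallest is_subspace M.

(* Defined through the polar form so as to be correct in characteristic 2. The
   polar form is symmetric, so linearity in one argument gives bilinearity. *)
Definition quadratic_form (q : vec -> F) : Prop :=
  (forall a x, q (a *: x) = a ^+ 2 * q x) /\
  (forall y, scalar (fun x => q (x + y) - q x - q y)).

Definition zeros (q : vec -> F) : set point :=
  [set P : point | forall x, x \in sval P -> q x = 0].

Definition is_quadric (S : set point) : Prop :=
  exists q, [/\ quadratic_form q, (exists x, q x != 0) & S = zeros q].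

Definition quad_closure (M : set point) : set point :=
  smallest [set S | is_quadric S \/ S = setT] M.

Definition is_collineation (k : point -> point) : Prop :=
  bijective k /\ forall l, is_line l -> is_line (k @` l).

End ProjectiveSpace.

Section QuadraticEmbedding.
Variables (n n' : nat) (F : fieldType) (nu : pg n F -> pg n' F).

Definition quadratic_embedding : Prop :=
  (forall M, quad_closure M = nu @^-1` lin_closure (nu @` M)) /\
  lin_closure (range nu) = setT.

Definition pl_regular (P : pg n F) (l : set (pg n F)) : Prop :=
  exists! m : set (pg n' F),
    [/\ is_line m, m `<=` lin_closure (nu @` l) & m `&` (nu @` l) = [set nu P]].

Definition regular : Prop := forall P l, is_line l -> l P -> pl_regular P l.

End QuadraticEmbedding.

(* The pairs i <= j in {0, ..., n}, in lexicographic order: they number the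
   homogeneous coordinates y_ij of the target of the Veronese embedding. *)
Definition upper_pairs (n : nat) : seq ('I_n.+1 * 'I_n.+1) :=
  [seq p : 'I_n.+1 * 'I_n.+1 <- [seq (i, j) | i <- enum 'I_n.+1, j <- enum 'I_n.+1]
     | (p.1 <= p.2)%N].

Definition veronese_dim (n : nat) : nat := ('C(n.+2, 2) - 1)%N.

Lemma mem_upper_pairs n (i j : 'I_n.+1) :
  ((i, j) \in upper_pairs n) = (i <= j)%N.
Proof.
rewrite mem_filter /=; case: (i <= j)%N => //=.
by apply/allpairsP; exists (i, j); rewrite !mem_enum.
Qed.

Lemma uniq_upper_pairs n : uniq (upper_pairs n).
Proof.
by apply/filter_uniq/allpairs_uniq; rewrite ?enum_uniq // => -[a b] [c d].
Qed.

Lemma size_upper_pairs n : size (upper_pairs n) = (veronese_dim n).+1.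
Proof.
have -> : (veronese_dim n).+1 = 'C(n.+2, 2).
  by rewrite /veronese_dim subn1 prednK // bin_gt0.
rewrite size_filter -sum1_count big_mkcond big_allpairs_dep /= big_enum /=.
rewrite -bin2_sum big_mkord big_ord_recl /= add0n (reindex_inj rev_ord_inj) /=.
apply: eq_bigr => i _; rewrite big_enum -big_mkcond /=.
rewrite -(big_geq_mkord _ _ predT (fun=> 1%N)) sum_nat_const_nat muln1.
by rewrite subKn.
Qed.

Section Veronese.
Variables (n : nat) (F : fieldType).

Definition veronese_vec (x : 'rV[F]_n.+1) : 'rV[F]_(veronese_dim n).+1 :=
  \row_k (let: (i, j) := nth (ord0, ord0) (upper_pairs n) k in x 0 i * x 0 j).

Lemma veronese_vec_coord (x : 'rV[F]_n.+1) (i j : 'I_n.+1) : (i <= j)%N ->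
  veronese_vec x 0 (inord (index (i, j) (upper_pairs n))) = x 0 i * x 0 j.
Proof.
rewrite -mem_upper_pairs => ij; rewrite mxE inordK ?nth_index //.
by rewrite -size_upper_pairs index_mem.
Qed.

Lemma veronese_vec_neq0 (x : 'rV[F]_n.+1) : x != 0 -> veronese_vec x != 0.
Proof.
apply: contra_neq => vx0; apply/rowP => i.
have := veronese_vec_coord x (leqnn i); rewrite vx0 !mxE => /esym/eqP.
by rewrite mulf_eq0 orbb => /eqP.
Qed.

Lemma veronese_vecZ (a : F) (x : 'rV[F]_n.+1) :
  veronese_vec (a *: x) = a ^+ 2 *: veronese_vec x.
Proof.
by apply/rowP => k; rewrite !mxE; case: nth => i j; rewrite !mxE mulrACA.
Qed.

Lemma pg_vpick_neq0 (P : pg n F) : vpick (sval P) != 0.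
Proof. by rewrite vpick0 -dimv_eq0 (eqP (svalP P)). Qed.

(* The value does not depend on the representative, see veroneseE. *)
Definition veronese (P : pg n F) : pg (veronese_dim n) F :=
  pg_vec (veronese_vec_neq0 (pg_vpick_neq0 P)).

Lemma veroneseE (x : 'rV[F]_n.+1) (nz_x : x != 0) :
  veronese (pg_vec nz_x) = pg_vec (veronese_vec_neq0 nz_x).
Proof.
apply: val_inj => /=.
have /vlineP[a ax] := memv_pick <[x]>%VS.
have a0 : a != 0.
  apply: contra_neq (pg_vpick_neq0 (pg_vec nz_x)) => a0.
  by rewrite /= ax a0 scale0r.
rewrite ax veronese_vecZ; apply/eqP.
rewrite eqEsubv -!memvE memvZ ?memv_line //=.
by apply/vlineP; exists (a ^- 2); rewrite scalerK // expf_neq0.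
Qed.

End Veronese.

(* Main.v *)
(* Choose representatives v(x) of the points nu(x). The embedding property says
   that linear dependence among the v(x) is quadratic dependence among the x, so
   a form x_i b, with b linear and not proportional to x_i, yields a linear
   functional, unique up to a factor, vanishing at v(x) exactly when x_i b(x) = 0.
   Fix i and regard x_i <> 0 as an affine space. Regularity provides a functional
   u_i vanishing at the v(x) with x_i = 0 and, on each coordinate axis through
   e_i, at no other point: it is the square x_i^2 of the Veronese model, and the
   functional of every x_i b that does not vanish on the affine part of an axis
   agrees with u_i there up to a factor. With u_j the functional of x_i x_j, the
   hyperplanes x_j = t x_i, x_j = r x_k and x_j = x_k + r x_i therefore give
   u_j(v(x)) = s(x_j / x_i) u_i(v(x)) with s multiplicative and additive, and s is
   onto because a functional u_j - c u_i without zeros on the affine axis would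
   be proportional to u_i on it. Comparing the charts i shows that all s agree
   and that, after normalization at (1, ..., 1), the functionals phi_ij = phi_ji
   satisfy phi_ij(v(x)) = a s(x_i x_j); so nu is the Veronese map followed by s
   and a linear bijection. *)
Require Import Defs.
From mathcomp Require Import all_boot all_algebra.
From mathcomp Require Import boolp classical_sets ring.

Set Implicit Arguments.
Unset Strict Implicit.
Unset Printing Implicit Defensive.

Import GRing.Theory.
Local Open Scope classical_set_scope.
Local Open Scope ring_scope.

(** * Columns as linear functionals on row vectors *)

Section RowColumn.
Variables (m : nat) (F : fieldType).
Implicit Types (x y : 'rV[F]_m) (b c : 'cV[F]_m).

Lemma row_colDl x y b : ((x + y) *m b) 0 0 = (x *m b) 0 0 + (y *m b) 0 0.
Proof. by rewrite mulmxDl [LHS]mxE. Qed.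

Lemma row_colZl a x b : ((a *: x) *m b) 0 0 = a * (x *m b) 0 0.
Proof. by rewrite -scalemxAl [LHS]mxE. Qed.

Lemma row_colBl x y b : ((x - y) *m b) 0 0 = (x *m b) 0 0 - (y *m b) 0 0.
Proof. by rewrite mulmxBl !mxE. Qed.

Lemma row_colZr a x b : (x *m (a *: b)) 0 0 = a * (x *m b) 0 0.
Proof. by rewrite -scalemxAr [LHS]mxE. Qed.

Lemma row_colDr x b c : (x *m (b + c)) 0 0 = (x *m b) 0 0 + (x *m c) 0 0.
Proof. by rewrite mulmxDr [LHS]mxE. Qed.

Lemma row_colBr x b c : (x *m (b - c)) 0 0 = (x *m b) 0 0 - (x *m c) 0 0.
Proof. by rewrite mulmxBr !mxE. Qed.

Lemma row_col_delta k b : (delta_mx (0 : 'I_1) k *m b) 0 0 = b k 0.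
Proof. by rewrite -rowE mxE. Qed.

Lemma row_col_coord x k : (x *m delta_mx k (0 : 'I_1)) 0 0 = x 0 k.
Proof. by rewrite -colE mxE. Qed.

End RowColumn.

(** * Points, lines and hyperplanes of projective space *)

Section ProjectiveSpace.
Variables (n : nat) (F : fieldType).
Implicit Types (P : pg n F) (x y : 'rV[F]_n.+1).

Lemma pg_vpickE P : sval P = <[vpick (sval P)]>%VS.
Proof.
apply/esym/eqP; rewrite eqEdim -memvE memv_pick dim_vline.
by rewrite pg_vpick_neq0 (eqP (svalP P)).
Qed.

Lemma pgE P : P = pg_vec (pg_vpick_neq0 P).
Proof. by apply: val_inj; rewrite /= -pg_vpickE. Qed.

Lemma vline_eq x y : y != 0 -> y \in <[x]>%VS -> <[y]>%VS = <[x]>%VS.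
Proof.
move=> y0 yx; apply/eqP; rewrite eqEdim -memvE yx !dim_vline y0.
by case: (x != 0).
Qed.

(** The projection along [U] onto a complement has kernel [U], so some coordinate of its value at
    [y] is nonzero; that coordinate is the functional. *)
Lemma exists_separating_functional (U : {vspace 'rV[F]_n.+1}) y : y \notin U ->
  exists2 f : 'cV[F]_n.+1,
    (y *m f) 0 0 != 0 & forall x, x \in U -> (x *m f) 0 0 = 0.
Proof.
move=> yU; pose g := (\1 - projv U)%VF.
have gy : g y != 0.
  rewrite !lfunE /= !lfunE /= subr_eq0; apply: contraNneq yU => ->.
  exact: memv_proj.
have [k gyk] : exists k, g y 0 k != 0 by apply/rV0Pn.
have colE x : (x *m col k (lin1_mx g)) 0 0 = g x 0 k.
  by rewrite -mul_rV_lin1 !mxE; apply: eq_bigr => j _; rewrite !mxE.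
exists (col k (lin1_mx g)) => [|x xU]; first by rewrite colE.
by rewrite colE !lfunE /= !lfunE /= projv_id // subrr mxE.
Qed.

Definition hyperplane (f : 'cV[F]_n.+1) : {vspace 'rV[F]_n.+1} :=
  lker (linfun (mulmxr f)).

Lemma mem_hyperplane f x : (x \in hyperplane f) = ((x *m f) 0 0 == 0).
Proof.
rewrite memv_ker lfunE /=; apply/eqP/eqP => [->|xf]; first by rewrite mxE.
by apply/rowP => j; rewrite ord1 xf mxE.
Qed.

Lemma dim_vline2 x y : x != 0 -> y \notin <[x]>%VS ->
  \dim (<[x]> + <[y]>)%VS = 2%N.
Proof.
move=> x0 yx; have y0 : y != 0 by apply: contraNneq yx => ->; exact: mem0v.
rewrite dimv_disjoint_sum ?dim_vline ?x0 ?y0 //; apply/eqP.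
rewrite -subv0; apply/subvP => z /memv_capP[zx zy].
rewrite memv0; apply: contraNT yx => z0.
by rewrite -(vline_eq z0 zx) (vline_eq z0 zy) memv_line.
Qed.

Lemma mem_vline2 x y z :
  reflect (exists a b, z = a *: x + b *: y) (z \in (<[x]> + <[y]>)%VS).
Proof.
apply: (iffP memv_addP) => [[_ /vlineP[a ->] [_ /vlineP[b ->] ->]]|[a [b ->]]].
  by exists a, b.
by exists (a *: x); [|exists (b *: y)]; rewrite ?memvZ ?memv_line.
Qed.

Lemma dim2_vline2 (U : {vspace 'rV[F]_n.+1}) : \dim U = 2%N ->
  exists x y, [/\ x != 0, y \notin <[x]>%VS & U = (<[x]> + <[y]>)%VS].
Proof.
move=> dU; pose x := vpick U.
have x0 : x != 0 by rewrite vpick0 -dimv_eq0 dU.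
have /subvPn[y yU yx] : ~~ (U <= <[x]>)%VS.
  by apply/negP => /dimvS; rewrite dU dim_vline x0.
exists x, y; split=> //; apply/esym/eqP; rewrite eqEdim dim_vline2 // dU leqnn.
by rewrite andbT subv_add -!memvE memv_pick.
Qed.

(** * Semilinear bijections induce collineations *)

Section Semilinear.
Variables (s t : F -> F) (f g : 'rV[F]_n.+1 -> 'rV[F]_n.+1).
Hypothesis tsK : cancel t s.
Hypotheses (fgK : cancel f g) (gfK : cancel g f).
Hypothesis fZD : forall a b x y, f (a *: x + b *: y) = s a *: f x + s b *: f y.
Hypothesis s0 : s 0 = 0.

Let f0 : f 0 = 0.
Proof. by have := fZD 0 0 0 0; rewrite !scale0r addr0 s0 !scale0r addr0. Qed.

Let gZD a b x y : g (a *: x + b *: y) = t a *: g x + t b *: g y.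
Proof. by apply: (can_inj fgK); rewrite gfK fZD !gfK !tsK. Qed.

Let fZ a x : f (a *: x) = s a *: f x.
Proof. by have := fZD a 0 x 0; rewrite s0 !scale0r !addr0. Qed.

Let f_eq0 x : (f x == 0) = (x == 0).
Proof. by rewrite -{1}f0 (inj_eq (can_inj fgK)). Qed.

Lemma semilinear_neq0 x : x != 0 -> f x != 0.
Proof. by rewrite f_eq0. Qed.

Definition semilinear_pg P : pg n F :=
  pg_vec (semilinear_neq0 (pg_vpick_neq0 P)).

Let f_vline x y : (f y \in <[f x]>%VS) = (y \in <[x]>%VS).
Proof.
apply/vlineP/vlineP => -[a]; last by move=> ->; exists (s a); rewrite fZ.
move=> fy; exists (t a); apply: (can_inj fgK).
by rewrite fZ tsK.
Qed.

Lemma semilinear_pgE x (nz_x : x != 0) :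
  semilinear_pg (pg_vec nz_x) = pg_vec (semilinear_neq0 nz_x).
Proof.
apply: val_inj; apply: vline_eq; last by rewrite f_vline memv_pick.
exact/semilinear_neq0/pg_vpick_neq0.
Qed.

Let g_neq0 x : x != 0 -> g x != 0.
Proof. by move=> x0; rewrite -f_eq0 gfK. Qed.

Lemma semilinear_pg_bij : bijective semilinear_pg.
Proof.
exists (fun P => pg_vec (g_neq0 (pg_vpick_neq0 P))) => P; last first.
  by rewrite semilinear_pgE [RHS]pgE; apply: val_inj; rewrite /= gfK.
rewrite [RHS]pgE; apply: val_inj; set z := vpick (sval (semilinear_pg P)).
have z0 : z != 0 by exact: pg_vpick_neq0.
apply: (vline_eq (g_neq0 z0)).
by rewrite -f_vline gfK; exact: memv_pick.
Qed.

Lemma semilinear_pg_collineation : is_collineation semilinear_pg.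
Proof.
split; first exact: semilinear_pg_bij.
move=> _ [U /dim2_vline2[x [y [x0 yx ->]]] ->].
exists (<[f x]> + <[f y]>)%VS; first by rewrite dim_vline2 ?f_vline ?f_eq0.
apply/seteqP; split=> [_ [P PU <-]|Q QU].
  rewrite /pg_points /= -memvE; apply/mem_vline2.
  have /mem_vline2[a [b ->]] := subvP PU _ (memv_pick _).
  by exists (s a), (s b); rewrite fZD.
pose z := vpick (sval Q); have z0 : z != 0 by exact: pg_vpick_neq0.
have /mem_vline2[a [b zE]] := subvP QU _ (memv_pick _ : z \in sval Q).
exists (pg_vec (g_neq0 z0)).
  rewrite /pg_points /= -memvE; apply/mem_vline2.
  exists (t a), (t b).
  by rewrite -[x in t a *: x]fgK -[y in t b *: y]fgK -gZD -zE.
by rewrite semilinear_pgE [RHS]pgE; apply: val_inj; rewrite /= gfK.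
Qed.

End Semilinear.
End ProjectiveSpace.

(** * Quadratic forms and their polar forms *)

Section QuadraticForms.
Variables (n : nat) (F : fieldType).
Implicit Types (x y z : 'rV[F]_n.+1) (q : 'rV[F]_n.+1 -> F).

Definition polar q x y := q (x + y) - q x - q y.

Lemma quadratic0 q : quadratic_form q -> q 0 = 0.
Proof. by move=> [qZ _]; rewrite -(scale0r 0) qZ expr0n mul0r. Qed.

Lemma quadraticD q x y : q (x + y) = q x + q y + polar q x y.
Proof. by rewrite /polar; ring. Qed.

Lemma polarC q x y : polar q x y = polar q y x.
Proof. by rewrite /polar (addrC y); ring. Qed.

Lemma polarZDl q a x y z : quadratic_form q ->
  polar q (a *: x + y) z = a * polar q x z + polar q y z.
Proof. by case=> _ /(_ z a x y). Qed.

Lemma polarZDr q a x y z : quadratic_form q ->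
  polar q z (a *: x + y) = a * polar q z x + polar q z y.
Proof. by move=> qq; rewrite !(polarC _ z) polarZDl. Qed.

Lemma polar0l q x : quadratic_form q -> polar q 0 x = 0.
Proof. by move=> qq; rewrite /polar quadratic0 // add0r subr0 subrr. Qed.

Lemma polarZl q a x y : quadratic_form q -> polar q (a *: x) y = a * polar q x y.
Proof. by move=> qq; rewrite -[a *: x]addr0 polarZDl // polar0l // addr0. Qed.

Lemma polarZr q a x y : quadratic_form q -> polar q x (a *: y) = a * polar q x y.
Proof. by move=> qq; rewrite !(polarC _ x) polarZl. Qed.

Lemma quadratic_mul (i : 'I_n.+1) (b : 'cV[F]_n.+1) :
  quadratic_form (fun x => x 0 i * (x *m b) 0 0).
Proof.
split=> [a x|y a x z]; first by rewrite row_colZl mxE; ring.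
by rewrite !row_colDl row_colZl !mxE; ring.
Qed.

Lemma zerosE q x (nz_x : x != 0) : quadratic_form q ->
  zeros q (pg_vec nz_x) <-> q x = 0.
Proof.
move=> [qZ _]; split=> [|qx0 _ /vlineP[a ->]]; last by rewrite qZ qx0 mulr0.
by apply; exact: memv_line.
Qed.

End QuadraticForms.

(** * Linear functionals pulled back along the embedding *)

Section Representatives.
Variables (n n' : nat) (F : fieldType) (nu : pg n F -> pg n' F).
Implicit Types (x y : 'rV[F]_n.+1) (f : 'cV[F]_n'.+1).

(** Depends only on the vector line of [x]: rescaling [x] does not rescale the value. The default 0
    lets later statements range over all vectors. *)
Definition rep x : 'rV[F]_n'.+1 :=
  if insub <[x]>%VS is Some P then vpick (sval (nu P)) else 0.

(** Since [rep x] is an arbitrary representative, only vanishing and the ratios of several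
    functionals at one [x] have a geometric meaning. *)
Definition ev f x : F := (rep x *m f) 0 0.

Lemma rep0 : rep 0 = 0.
Proof. by rewrite /rep insubF // dim_vline eqxx. Qed.

Lemma repE x (nz_x : x != 0) : rep x = vpick (sval (nu (pg_vec nz_x))).
Proof. by rewrite /rep (insubT (fun U => \dim U == 1%N) (pg_vec_subproof nz_x)). Qed.

Lemma rep_neq0 x : x != 0 -> rep x != 0.
Proof. by move=> nz_x; rewrite repE; exact: pg_vpick_neq0. Qed.

Lemma nu_vline x (nz_x : x != 0) : sval (nu (pg_vec nz_x)) = <[rep x]>%VS.
Proof. by rewrite repE; exact: pg_vpickE. Qed.

Lemma ev0 f : ev f 0 = 0.
Proof. by rewrite /ev rep0 mul0mx mxE. Qed.

Lemma evD f1 f2 x : ev (f1 + f2) x = ev f1 x + ev f2 x.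
Proof. exact: row_colDr. Qed.

Lemma evZ a f x : ev (a *: f) x = a * ev f x.
Proof. exact: row_colZr. Qed.

Lemma evB f1 f2 x : ev (f1 - f2) x = ev f1 x - ev f2 x.
Proof. exact: row_colBr. Qed.

Lemma ev_sum I (r : seq I) (P : pred I) (h : I -> 'cV[F]_n'.+1) x :
  ev (\sum_(k <- r | P k) h k) x = \sum_(k <- r | P k) ev (h k) x.
Proof. by rewrite /ev mulmx_sumr summxE. Qed.

Lemma ev_pg_points f x (nz_x : x != 0) :
  pg_points (hyperplane f) (nu (pg_vec nz_x)) <-> ev f x = 0.
Proof.
rewrite /pg_points /= nu_vline -memvE mem_hyperplane.
by split=> /eqP.
Qed.

Hypothesis hnu : quadratic_embedding nu.

(** A nonzero [y] spans a point in the quadratic closure of the points of [S], so [nu] sends it into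
    the linear closure of their images, which the hyperplane of [f] contains. *)
Lemma ev_closure (S : set 'rV[F]_n.+1) f y :
  (forall q, quadratic_form q -> (forall x, S x -> q x = 0) -> q y = 0) ->
  (forall x, S x -> ev f x = 0) -> ev f y = 0.
Proof.
move=> Sq Sf; have [->|nz_y] := eqVneq y 0; first exact: ev0.
pose M := [set P | exists x (nz_x : x != 0), S x /\ P = pg_vec nz_x].
have : quad_closure M (pg_vec nz_y).
  move=> A [[[q [qq _ ->]]|->] // MA]; apply/zerosE => //.
  apply: Sq => // x Sx; have [->|nz_x] := eqVneq x 0; first exact: quadratic0.
  by apply/(zerosE nz_x qq)/MA; exists x, nz_x.
rewrite (proj1 hnu) => yM; apply/(ev_pg_points f nz_y); apply: yM.
split=> [|_ [_ [x [nz_x [Sx ->]]] <-]]; first by exists (hyperplane f).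
by apply/ev_pg_points; exact: Sf.
Qed.

Lemma ev_eq0 f : (forall x, ev f x = 0) -> f = 0.
Proof.
move=> f0; have fT Q : pg_points (hyperplane f) Q.
  have : [set: pg n' F] Q by [].
  rewrite -(proj2 hnu); apply; split=> [|_ [P _ <-]]; first by exists (hyperplane f).
  by rewrite (pgE P); apply/ev_pg_points.
apply/colP => k; rewrite mxE.
have d0 : delta_mx 0 k != 0 :> 'rV[F]_n'.+1.
  by apply/rV0Pn; exists k; rewrite mxE !eqxx oner_eq0.
have := fT (pg_vec d0).
by rewrite /pg_points /= -memvE mem_hyperplane row_col_delta => /eqP.
Qed.

(** The zero set of [q] is quadratically closed and misses [y], so the span of its image misses the
    image of [y]; a functional separates them. *)
Lemma exists_ev_neq0 q y : quadratic_form q -> q y != 0 ->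
  exists2 f, ev f y != 0 & forall x, q x = 0 -> ev f x = 0.
Proof.
move=> qq qy; have nz_y : y != 0.
  by apply: contraNneq qy => ->; rewrite quadratic0.
have : ~ quad_closure (zeros q) (pg_vec nz_y).
  move=> yM; case/eqP: (qy); apply/(zerosE nz_y qq); apply: yM.
  by split=> //; left; exists q; split=> //; exists y.
rewrite (proj1 hnu) => yM.
have [U [UM yU]] : exists U : {vspace 'rV[F]_n'.+1},
    nu @` zeros q `<=` pg_points U /\ rep y \notin U.
  apply: contrapT => noU; apply: yM => A [[U ->] UM].
  have [yU|yU] := boolP (rep y \in U); last by case: noU; exists U.
  by rewrite /pg_points /= nu_vline -memvE.
have [f fy fU] := exists_separating_functional yU.
exists f => // x qx; have [->|nz_x] := eqVneq x 0; first exact: ev0.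
apply: fU; rewrite memvE -nu_vline; apply: UM.
by exists (pg_vec nz_x) => //; apply/zerosE.
Qed.

End Representatives.

Definition std n (F : fieldType) (k : 'I_n.+1) : 'rV[F]_n.+1 := delta_mx 0 k.

Lemma stdE n (F : fieldType) (j k : 'I_n.+1) : std F j 0 k = (k == j)%:R.
Proof. by rewrite mxE eqxx. Qed.

(** * Quadratic forms vanishing on a coordinate hyperplane *)

Section PairOfHyperplanes.
Variables (n : nat) (F : fieldType) (i : 'I_n.+1).
Implicit Types (x y : 'rV[F]_n.+1) (q : 'rV[F]_n.+1 -> F) (b : 'cV[F]_n.+1).

Local Notation e := (@std n F).

Definition axis k t : 'rV[F]_n.+1 := e i + t *: e k.

Lemma axisE j t k : axis j t 0 k = (k == i)%:R + t * (k == j)%:R.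
Proof. by rewrite !mxE eqxx. Qed.

Lemma axis_eval b j t : (axis j t *m b) 0 0 = b i 0 + t * b j 0.
Proof. by rewrite row_colDl row_colZl !row_col_delta. Qed.

Lemma axis0 j : axis j (0 : F) = e i.
Proof. by rewrite /axis scale0r addr0. Qed.

Lemma axis_base j t : j != i -> axis j t 0 i = 1.
Proof. by move=> ji; rewrite axisE eqxx (eq_sym i) (negPf ji) mulr0 addr0. Qed.

Lemma axis_own j t : j != i -> axis j t 0 j = t.
Proof. by move=> ji; rewrite axisE eqxx (negPf ji) add0r mulr1. Qed.

Lemma axis_other j k t : k != i -> k != j -> axis j t 0 k = 0.
Proof. by move=> ki kj; rewrite axisE (negPf ki) (negPf kj) mulr0 addr0. Qed.

(* A form vanishing on [x 0 i = 0] is [x 0 i] times this linear form. *)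
Definition hyperplane_cofactor q x : F :=
  x 0 i * q (e i) + polar q (e i) (x - x 0 i *: e i).

Lemma hyperplane_cofactorE q x : quadratic_form q ->
  (forall x, x 0 i = 0 -> q x = 0) -> q x = x 0 i * hyperplane_cofactor q x.
Proof.
move=> qq q0; have [qZ _] := qq.
have qh : q (x - x 0 i *: e i) = 0.
  by apply: q0; rewrite !mxE !eqxx mulr1 subrr.
rewrite -{1}[x](subrK (x 0 i *: e i)) addrC quadraticD qZ qh polarZl //.
by rewrite /hyperplane_cofactor; ring.
Qed.

Lemma hyperplane_cofactorZD q a x y : quadratic_form q ->
  hyperplane_cofactor q (a *: x + y) =
    a * hyperplane_cofactor q x + hyperplane_cofactor q y.
Proof.
move=> qq; rewrite /hyperplane_cofactor.
have -> : a *: x + y - (a *: x + y) 0 i *: e i =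
    a *: (x - x 0 i *: e i) + (y - y 0 i *: e i).
  by apply/rowP => k; rewrite !mxE; ring.
by rewrite polarZDr // !mxE; ring.
Qed.

(* The cofactor vanishes on the affine part of [b = 0], which spans [b = 0]. *)
Lemma quadratic_pair_eq0 q b k y : quadratic_form q -> k != i -> b k 0 != 0 ->
  (forall x, x 0 i * (x *m b) 0 0 = 0 -> q x = 0) ->
  y 0 i * (y *m b) 0 0 != 0 -> q y = 0 -> forall x, q x = 0.
Proof.
move=> qq ki bk qb; rewrite mulf_eq0 negb_or => /andP[yi yb] qy.
have qi x : x 0 i = 0 -> q x = 0 by move=> xi; apply: qb; rewrite xi mul0r.
pose L := hyperplane_cofactor q.
have qE x : q x = x 0 i * L x by exact: hyperplane_cofactorE.
have LZD a x z : L (a *: x + z) = a * L x + L z by exact: hyperplane_cofactorZD.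
have Lq x : x 0 i != 0 -> q x = 0 -> L x = 0.
  by move=> xi /eqP; rewrite qE mulf_eq0 (negPf xi) => /eqP.
(* The point where the axis meets [b = 0]; adding it moves vectors of [b = 0] at infinity into the
   affine part. *)
pose z := axis k (- (b i 0 / b k 0)).
have zi : z 0 i = 1 by rewrite axisE eqxx (eq_sym i) (negPf ki) mulr0 addr0.
have zb : (z *m b) 0 0 = 0 by rewrite axis_eval mulNr divfK // subrr.
have Lz : L z = 0 by apply: Lq; rewrite ?qb ?zb ?mulr0 ?zi ?oner_eq0.
have Lb x : (x *m b) 0 0 = 0 -> L x = 0.
  move=> xb; have [xi|xi] := eqVneq (x 0 i) 0; last first.
    by apply: Lq => //; apply: qb; rewrite xb mulr0.
  have := LZD 1 x z; rewrite scale1r mul1r Lz addr0 => <-; apply: Lq.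
    by rewrite mxE xi zi add0r oner_eq0.
  by apply: qb; rewrite row_colDl xb zb addr0 mulr0.
move=> x; rewrite qE.
pose c := (x *m b) 0 0 / (y *m b) 0 0.
have -> : x = c *: y + (x - c *: y) by rewrite addrC subrK.
rewrite LZD Lq // Lb ?mulr0 ?addr0 ?mulr0 //.
by rewrite row_colBl row_colZl divfK ?subrr.
Qed.

(** The cofactor of [x 0 i] is linear, and the given zeros make it vanish at every basis vector. *)
Lemma quadratic_frame_eq0 q : quadratic_form q ->
  (forall x, x 0 i = 0 -> q x = 0) -> q (e i) = 0 ->
  (forall k, k != i -> q (axis k 1) = 0) -> forall x, q x = 0.
Proof.
move=> qq qi qe qa x.
pose L := hyperplane_cofactor q.
have qE y : q y = y 0 i * L y by exact: hyperplane_cofactorE.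
have LZD a y z : L (a *: y + z) = a * L y + L z by exact: hyperplane_cofactorZD.
have L0 : L 0 = 0.
  by have := LZD (-1) 0 0; rewrite scaler0 addr0 mulN1r addNr.
have Le k : L (e k) = 0.
  have Li : L (e i) = 0.
    by have := qE (e i); rewrite qe stdE eqxx mul1r => <-.
  have [->//|ki] := eqVneq k i.
  have := qE (axis k 1); rewrite qa // axisE eqxx (eq_sym i) (negPf ki) mulr0 addr0.
  by rewrite mul1r /axis addrC LZD Li addr0 mul1r => <-.
rewrite qE (_ : L x = 0) ?mulr0 // (row_sum_delta x).
elim/big_ind: _ => // [y z Ly Lz|k _].
  by have := LZD 1 y z; rewrite scale1r mul1r Ly Lz addr0.
by have := LZD (x 0 k) (e k) 0; rewrite !addr0 L0 Le mulr0 addr0.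
Qed.

Lemma quadratic_line_eq0 q k t : quadratic_form q -> k != i ->
  q (e i) = 0 -> q (e k) = 0 -> q (axis k 1) = 0 -> q (axis k t) = 0.
Proof.
move=> qq ki qi qk; have [qZ _] := qq.
rewrite /axis !quadraticD !qZ qi qk !polarZr // !mulr0 !add0r mul1r => ->.
by rewrite mulr0.
Qed.

End PairOfHyperplanes.

(** * Functionals belonging to pairs of hyperplanes *)

Section PairFunctionals.
Variables (n n' : nat) (F : fieldType) (nu : pg n F -> pg n' F).
Hypothesis hnu : quadratic_embedding nu.
Implicit Types (x y : 'rV[F]_n.+1) (f g : 'cV[F]_n'.+1) (b : 'cV[F]_n.+1).
Local Notation ev := (ev nu).
Local Notation e := (@std n F).

(** Some functional vanishes on the pair but not at a chosen [y]. If it vanished at a further [x]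
    off the pair, it would vanish at [y] too, because a quadratic form vanishing on the pair and at
    [x] is zero. *)
Lemma exists_pair_functional (i k : 'I_n.+1) b : k != i -> b k 0 != 0 ->
  exists f, forall x, (ev f x == 0) = (x 0 i == 0) || ((x *m b) 0 0 == 0).
Proof.
move=> ki bk; have qq := quadratic_mul i b; set q := fun x => _ in qq.
have [y qy] : exists y, q y != 0.
  have [bi|bi] := eqVneq (b i 0) 0; last first.
    by exists (e i); rewrite /q row_col_delta stdE eqxx mul1r.
  exists (axis i k 1); rewrite /q axis_eval bi add0r mul1r axisE eqxx.
  by rewrite (eq_sym i) (negPf ki) mulr0 addr0 mul1r.
have [f fy fq] := exists_ev_neq0 hnu qq qy.
exists f => x; rewrite -mulf_eq0; apply/eqP/eqP => [fx|]; last exact: fq.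
apply: contrapT => /eqP qx; case/eqP: fy.
apply: (ev_closure hnu (S := [set z | q z = 0 \/ z = x])) => [p pp Sp|z [/fq//|->//]].
apply: (quadratic_pair_eq0 pp ki bk _ qx); last by apply: Sp; right.
by move=> z qz; apply: Sp; left.
Qed.

Lemma pair_functional_inj (i k : 'I_n.+1) b f g y : k != i -> b k 0 != 0 ->
  (forall x, x 0 i * (x *m b) 0 0 = 0 -> ev f x = 0) ->
  (forall x, x 0 i * (x *m b) 0 0 = 0 -> ev g x = 0) ->
  y 0 i * (y *m b) 0 0 != 0 -> ev f y = ev g y -> f = g.
Proof.
move=> ki bk f0 g0 qy fgy; apply/eqP; rewrite -subr_eq0; apply/eqP.
apply: (ev_eq0 hnu) => x.
pose S := [set z : 'rV[F]_n.+1 | z 0 i * (z *m b) 0 0 = 0 \/ z = y].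
apply: (ev_closure hnu (S := S)) => [p pp Sp|z [qz|->]]; rewrite ?evB.
- apply: (quadratic_pair_eq0 pp ki bk _ qy); last by apply: Sp; right.
  by move=> z qz; apply: Sp; left.
- by rewrite f0 // g0 // subrr.
- by rewrite fgy subrr.
Qed.

Lemma frame_functional_eq0 (i : 'I_n.+1) f :
  (forall x, x 0 i = 0 -> ev f x = 0) -> ev f (e i) = 0 ->
  (forall k, k != i -> ev f (axis i k 1) = 0) -> f = 0.
Proof.
move=> fi fe fa; apply: (ev_eq0 hnu) => x.
pose S := [set z : 'rV[F]_n.+1 |
  z 0 i = 0 \/ z = e i \/ exists2 k, k != i & z = axis i k 1].
apply: (ev_closure hnu (S := S)) => [q qq Sq|z [/fi//|[->//|[k ki ->]]]]; last exact: fa.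
apply: (quadratic_frame_eq0 (i := i) qq) => [z zi||k ki]; apply: Sq.
- by left.
- by right; left.
- by right; right; exists k.
Qed.

Lemma line_functional_eq0 (i k : 'I_n.+1) f t : k != i ->
  ev f (e i) = 0 -> ev f (e k) = 0 -> ev f (axis i k 1) = 0 ->
  ev f (axis i k t) = 0.
Proof.
move=> ki fi fk fa.
apply: (ev_closure hnu (S := [set z | [\/ z = e i, z = e k | z = axis i k 1]])).
  by move=> q qq Sq; apply: quadratic_line_eq0 => //; apply: Sq; constructor.
by move=> z [->|->|->].
Qed.

Lemma axis_neq0 (i k : 'I_n.+1) (t : F) : k != i -> axis i k t != 0.
Proof.
move=> ki; apply/rV0Pn; exists i.
by rewrite axisE eqxx (eq_sym i) (negPf ki) mulr0 addr0 oner_eq0.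
Qed.

Lemma std_neq0 (k : 'I_n.+1) : e k != 0.
Proof. by apply/rV0Pn; exists k; rewrite stdE eqxx oner_eq0. Qed.

(** The hyperplane of such an [f] meets the image of the line through [e i] and [e k] only in the
    image of [e k]: it cuts out a unisecant there. *)
Definition tangent_on (i k : 'I_n.+1) f :=
  ev f (e k) = 0 /\ forall t, ev f (axis i k t) != 0.

Hypothesis rnu : regular nu.

(** * Regularity and the unisecants of the image of a line *)

Section Tangent.
Variables (i k : 'I_n.+1).
Hypothesis ki : k != i.
Let l := pg_points (<[e i]> + <[e k]>)%VS.

Let e_free : e k \notin <[e i]>%VS.
Proof.
apply/vlineP => -[a /rowP/(_ k)].
by rewrite !mxE !eqxx (negPf ki) mulr0 => /eqP; rewrite oner_eq0.
Qed.

(** The point of the secant through the images of [e i] and [axis i k 1] on the hyperplane of [f];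
    joined to the image of [e k] it gives the unisecant of a tangent [f]. *)
Let w f := ev f (e i) *: rep nu (axis i k 1) - ev f (axis i k 1) *: rep nu (e i).
Let m f := (<[rep nu (e k)]> + <[w f]>)%VS.

Let m_free f : ev f (e i) != 0 -> w f \notin <[rep nu (e k)]>%VS.
Proof.
have dk : delta_mx k (0 : 'I_1) k 0 != 0 :> F by rewrite mxE !eqxx oner_eq0.
(* The functional of x_i x_k vanishes at [e i] and [e k] but not at [axis i k 1], so it is nonzero
   on [w f]. *)
move=> fi; have [g gE] := exists_pair_functional ki dk.
have {}gE x : (ev g x == 0) = (x 0 i == 0) || (x 0 k == 0).
  by rewrite gE row_col_coord.
apply/vlineP => -[a wE].
have := congr1 (fun z => (z *m g) 0 0) wE.
rewrite row_colBl !row_colZl -!/(ev _ _).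
have /eqP -> : ev g (e i) == 0 by rewrite gE !stdE (negPf ki) !eqxx orbT.
have /eqP -> : ev g (e k) == 0 by rewrite gE !stdE (eq_sym i) (negPf ki) !eqxx.
rewrite !mulr0 subr0 => /eqP; rewrite mulf_eq0 (negPf fi) gE !axisE !eqxx.
by rewrite (negPf ki) (eq_sym i) (negPf ki) !mulr0 addr0 add0r mulr1 !oner_eq0.
Qed.

Let m_ker f z : ev f (e k) = 0 -> z \in m f -> (z *m f) 0 0 = 0.
Proof.
move=> fk /mem_vline2[a [c ->]].
rewrite row_colDl !row_colZl row_colBl !row_colZl -!/(ev _ _) fk.
by ring.
Qed.

Let m_tangent f : tangent_on i k f ->
  [/\ is_line (pg_points (m f)),
      pg_points (m f) `<=` lin_closure (nu @` l) &
      pg_points (m f) `&` (nu @` l) = [set nu (pg_vec (std_neq0 k))]].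
Proof.
move=> [fk ft]; have fi : ev f (e i) != 0.
  by have := ft 0; rewrite /axis scale0r addr0.
split.
- by exists (m f) => //; rewrite dim_vline2 ?rep_neq0 ?std_neq0 ?m_free.
- have inl x (nz_x : x != 0) (U : {vspace 'rV[F]_n'.+1}) :
      nu @` l `<=` pg_points U -> x \in (<[e i]> + <[e k]>)%VS -> rep nu x \in U.
    move=> lU xl; rewrite memvE -nu_vline; apply: lU; exists (pg_vec nz_x) => //.
  move=> Q Qm _ [[U ->] lU]; apply: subv_trans Qm _.
  rewrite subv_add -!memvE; apply/andP; split; [|apply: memvB; apply: memvZ];
    apply: inl => //; rewrite ?std_neq0 ?axis_neq0 //; apply/mem_vline2.
  + by exists 0, 1; rewrite scale0r scale1r add0r.
  + by exists 1, 1; rewrite /axis !scale1r.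
  + by exists 1, 0; rewrite scale0r scale1r addr0.
apply/seteqP; split=> [Q [Qm [P Pl PQ]]|_ ->]; last first.
  split; first by rewrite /pg_points /= nu_vline addvSl.
  exists (pg_vec (std_neq0 k)) => //; rewrite /l /pg_points /=; exact: addvSr.
rewrite /= -PQ in Qm *; congr (nu _); rewrite {Q PQ} (pgE P) in Pl Qm *.
move: (pg_vpick_neq0 P) Pl Qm; set x := vpick _ => nz_x xl xm.
move: xl; rewrite /l /pg_points /= -memvE => /mem_vline2[a [c xE]].
apply: val_inj => /=; apply: vline_eq => //; apply/vlineP.
(* A point of the line other than [e k] is a multiple of an axis point, where [f] does not
   vanish. *)
have [a0|a0] := eqVneq a 0; first by exists c; rewrite xE a0 scale0r add0r.
have aE : x = a *: axis i k (c / a).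
  by rewrite xE /axis scalerDr scalerA mulrC divfK.
have nz_a : axis i k (c / a) != 0 by exact: axis_neq0.
have Q : pg_vec nz_x = pg_vec nz_a.
  by apply: val_inj; apply: vline_eq; rewrite // aE memvZ ?memv_line.
by have /eqP[] := ft (c / a); apply: (m_ker fk); rewrite memvE -nu_vline -Q.
Qed.

(** By uniqueness of the unisecant [g] vanishes at [w f], which gives the ratio at [axis i k 1]. A
    combination of [f] and [g] then vanishes at three points of the line, hence on the whole
    axis. *)
Lemma tangent_functionals_proportional f g t :
  tangent_on i k f -> tangent_on i k g ->
  ev f (axis i k t) * ev g (e i) = ev f (e i) * ev g (axis i k t).
Proof.
move=> tf tg; have [fk _] := tf; have [gk gt] := tg.
have [fi gi] : ev f (e i) != 0 /\ ev g (e i) != 0.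
  by have := proj2 tf 0; have := proj2 tg 0; rewrite /axis scale0r addr0.
have lP : l (pg_vec (std_neq0 k)) by exact: addvSr.
have ll : is_line l.
  by exists (<[e i]> + <[e k]>)%VS => //; rewrite dim_vline2 ?std_neq0.
have [M [_ Mu]] := rnu ll lP.
have mfg : pg_points (m f) = pg_points (m g).
  by rewrite -(Mu _ (m_tangent tf)) -(Mu _ (m_tangent tg)).
have wg : ev g (axis i k 1) * ev f (e i) = ev g (e i) * ev f (axis i k 1).
  have nz_w : w f != 0.
    by apply: contraNneq (m_free fi) => ->; exact: mem0v.
  have : pg_points (m f) (pg_vec nz_w) by exact: addvSr.
  rewrite mfg /pg_points /= -memvE => /(m_ker gk) /eqP.
  rewrite row_colBl !row_colZl -!/(ev _ _) subr_eq0 => /eqP.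
  by rewrite mulrC => ->; rewrite mulrC.
pose h := ev g (e i) *: f - ev f (e i) *: g.
have : ev h (axis i k t) = 0.
  apply: line_functional_eq0 => //; rewrite evB !evZ ?fk ?gk ?mulr0 ?subrr //.
    by rewrite mulrC subrr.
  by rewrite -wg mulrC subrr.
by rewrite evB !evZ => /eqP; rewrite subr_eq0 => /eqP <-; rewrite mulrC.
Qed.

End Tangent.
End PairFunctionals.

Lemma exists_third n (i j : 'I_n.+1) :
  (2 <= n)%N -> exists2 k : 'I_n.+1, k != i & k != j.
Proof.
move=> n2; apply: contrapT => no; suff : (#|[set: 'I_n.+1]%SET| <= #|[set i; j]%SET|)%N.
  by rewrite cardsT card_ord cards2 leqNgt ltnS (leq_trans _ n2) // ltnS leq_b1.
apply/subset_leq_card/fintype.subsetP => k _; rewrite !inE.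
by apply: contrapT => /negP; rewrite negb_or => /andP[ki kj]; apply: no; exists k.
Qed.

(** * Affine coordinates in the chart where [x 0 i] is nonzero *)

Section AxisCoordinates.
Variables (n n' : nat) (F : fieldType) (nu : pg n F -> pg n' F).
Hypotheses (hnu : quadratic_embedding nu) (rnu : regular nu) (n2 : (2 <= n)%N).
Variable i : 'I_n.+1.
Implicit Types (j k l : 'I_n.+1) (x y : 'rV[F]_n.+1).
Implicit Types (f g : 'cV[F]_n'.+1) (b : 'cV[F]_n.+1).
Local Notation ev := (ev nu).
Local Notation e := (@std n F).
Local Notation axis := (@axis n F i).
Local Notation coord j := (delta_mx j 0 : 'cV[F]_n.+1).

Lemma coordE j k : coord j k 0 = (k == j)%:R.
Proof. by rewrite mxE eqxx andbT. Qed.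

Lemma tangent_of_pair k b f : k != i -> b i 0 != 0 -> b k 0 = 0 ->
  (forall x, (ev f x == 0) = (x 0 i == 0) || ((x *m b) 0 0 == 0)) ->
  tangent_on nu i k f.
Proof.
move=> ki bi bk fE; split=> [|t].
  by apply/eqP; rewrite fE stdE (eq_sym i) (negPf ki) eqxx.
by rewrite fE axis_base // oner_eq0 axis_eval bk mulr0 addr0 (negPf bi).
Qed.

(** In the Veronese model [f], [g], [h] correspond to x_i (x_j - x_i), x_i (x_k - x_i), x_i x_j. On
    every axis but that of [j], [f] is tangent and [h] vanishes; adding a multiple of [h] repairs
    [f] on the axis of [j], where [g] serves as a model. *)
Lemma exists_tangent_functional : exists2 f,
  forall x, x 0 i = 0 -> ev f x = 0 & forall k, k != i -> tangent_on nu i k f.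
Proof.
have [j ji _] := exists_third i i n2; have [k ki kj] := exists_third i j n2.
have pairE (l : 'I_n.+1) : l != i -> exists f, forall x,
    (ev f x == 0) = (x 0 i == 0) || ((x *m (coord l - coord i)) 0 0 == 0).
  move=> li; apply: (exists_pair_functional hnu li).
  by rewrite !mxE !eqxx (negPf li) subr0 oner_eq0.
have [f fE] := pairE j ji; have [g gE] := pairE k ki.
have [h hE] := exists_pair_functional hnu ji
  (ltac:(by rewrite coordE eqxx oner_eq0) : coord j j 0 != 0).
have ci (l : 'I_n.+1) : l != i -> (coord l - coord i) i 0 != 0.
  move=> li; rewrite !mxE !eqxx (eq_sym i) (negPf li) sub0r.
  by rewrite oppr_eq0 oner_eq0.
have cl (l m : 'I_n.+1) : m != i -> m != l -> (coord l - coord i) m 0 = 0.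
  by move=> mi ml; rewrite !mxE (negPf mi) (negPf ml) subrr.
have tf (m : 'I_n.+1) : m != i -> m != j -> tangent_on nu i m f.
  by move=> mi mj; apply: (tangent_of_pair mi (ci _ ji) (cl _ _ mi mj) fE).
have [gj gt] : tangent_on nu i j g.
  apply: (tangent_of_pair ji (ci _ ki) _ gE).
  by apply: cl => //; rewrite eq_sym.
have fA : ev f (axis j 1) = 0.
  apply/eqP; rewrite fE row_colBr !row_col_coord axis_own // axis_base //.
  by rewrite subrr eqxx orbT.
have hA : ev h (axis j 1) != 0.
  by rewrite hE row_col_coord axis_own // axis_base // oner_eq0.
have gi : ev g (e i) != 0 by have := gt 0; rewrite axis0.
have fi : ev f (e i) != 0 by have := proj2 (tf k ki kj) 0; rewrite axis0.
have hi : ev h (e i) = 0.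
  by apply/eqP; rewrite hE row_col_coord !stdE (negPf ji) !eqxx orbT.
have h0 x : x 0 i = 0 -> ev h x = 0 by move=> xi; apply/eqP; rewrite hE xi eqxx.
have f0 x : x 0 i = 0 -> ev f x = 0 by move=> xi; apply/eqP; rewrite fE xi eqxx.
have eki m : m != i -> e m 0 i = 0 by move=> mi; rewrite stdE eq_sym (negPf mi).
(* This [c] makes [f + c *: h] match [f] at [e i] and be proportional to [g] at [e i], [e j] and
   [axis j 1], hence on the whole axis. *)
pose c := ev g (axis j 1) * ev f (e i) / ev g (e i) / ev h (axis j 1).
exists (f + c *: h) => [x xi|m mi]; first by rewrite evD evZ f0 ?h0 // mulr0 addr0.
split=> [|t]; first by rewrite evD evZ f0 ?h0 ?mulr0 ?addr0 ?eki.
have [->|mj] := eqVneq m j; last first.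
  rewrite evD evZ (_ : ev h _ = 0) ?mulr0 ?addr0 //.
    exact: (proj2 (tf m mi mj)).
  by apply/eqP; rewrite hE row_col_coord (axis_other _ ji) ?eqxx ?orbT // eq_sym.
have : ev (ev g (e i) *: (f + c *: h) - ev f (e i) *: g) (axis j t) = 0.
  apply: line_functional_eq0 => //; rewrite evB !evZ evD evZ.
  - by rewrite hi mulr0 addr0 mulrC subrr.
  - by rewrite gj f0 ?h0 ?eki // !(mulr0, addr0, subr0).
  - by rewrite fA /c divfK // add0r mulrCA divff // mulr1 mulrC subrr.
rewrite evB !evZ => /eqP; rewrite subr_eq0 => /eqP gfh.
by have := mulf_neq0 fi (gt t); rewrite -gfh mulf_eq0 negb_or => /andP[].
Qed.

(** * Slopes along the axes, with [u i] in the role of x_i^2 and [u j] in that of x_i x_j *)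

Variable u : 'I_n.+1 -> 'cV[F]_n'.+1.
Hypothesis ui0 : forall x, x 0 i = 0 -> ev (u i) x = 0.
Hypothesis ut : forall k, k != i -> tangent_on nu i k (u i).
Hypothesis uE : forall j x, j != i ->
  (ev (u j) x == 0) = (x 0 i == 0) || (x 0 j == 0).
Hypothesis u1 : forall j, j != i -> ev (u j) (axis j 1) = ev (u i) (axis j 1).

Let u0 j x : x 0 i = 0 -> ev (u j) x = 0.
Proof.
have [->|ji] := eqVneq j i; first exact: ui0.
by move=> xi; apply/eqP; rewrite uE // xi eqxx.
Qed.

Let ui_axis k t : k != i -> ev (u i) (axis k t) != 0.
Proof. by move=> ki; case: (ut ki). Qed.

Let ui_e : ev (u i) (e i) != 0.
Proof.
have [k ki _] := exists_third i i n2.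
by have := ui_axis 0 ki; rewrite axis0.
Qed.

Let uj_e j : j != i -> ev (u j) (e i) = 0.
Proof. by move=> ji; apply/eqP; rewrite uE // !stdE (negPf ji) !eqxx orbT. Qed.

(* In the Veronese model, [(x_i) b] is the combination of the [x_i x_l] with the
   coefficients of [b]. Here only the support of the coefficients is controlled. *)
Lemma pair_functional_combination k b : k != i -> b k 0 != 0 ->
  exists2 c : 'I_n.+1 -> F, forall l, b l 0 = 0 -> c l = 0 &
    forall x, (\sum_l c l * ev (u l) x == 0) = (x 0 i == 0) || ((x *m b) 0 0 == 0).
Proof.
move=> ki bk; have [f fE] := exists_pair_functional hnu ki bk.
(* The coefficients are forced by the values on the frame: only [u i] survives at [e i], only [u i]
   and [u l] at [axis l 1]. *)
pose ci := ev f (e i) / ev (u i) (e i).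
pose c l := if l == i then ci else
  (ev f (axis l 1) - ci * ev (u i) (axis l 1)) / ev (u l) (axis l 1).
have ul1 l : l != i -> ev (u l) (axis l 1) != 0.
  by move=> li; rewrite u1 // ui_axis.
have fc : f = \sum_l c l *: u l.
  apply/eqP; rewrite -subr_eq0; apply/eqP.
  have evc x : ev (f - \sum_l c l *: u l) x = ev f x - \sum_l c l * ev (u l) x.
    by rewrite evB ev_sum; congr (_ - _); apply: eq_bigr => l _; rewrite evZ.
  apply: (frame_functional_eq0 hnu (i := i)) => [x xi||l li]; rewrite evc.
  - rewrite big1 ?subr0 => [|l _]; last by rewrite u0 ?mulr0.
    by apply/eqP; rewrite fE xi eqxx.
  - rewrite (bigD1 i) //= big1 => [|l li]; last by rewrite uj_e ?mulr0.
    by rewrite /c eqxx divfK // addr0 subrr.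
  rewrite (bigD1 i) //= (bigD1 l) //= big1 => [|m /andP[mi ml]].
    by rewrite /c eqxx (negPf li) divfK ?ul1 // addr0 addrC subrK subrr.
  have /eqP -> : ev (u m) (axis l 1) == 0; last by rewrite mulr0.
  by rewrite uE // (axis_other _ mi ml) eqxx orbT.
exists c => [l bl|x]; last first.
  by rewrite -fE fc ev_sum; under [in RHS]eq_bigr do rewrite evZ.
rewrite /c /ci; have [li|li] := eqVneq l i.
  apply/eqP; rewrite mulf_eq0 fE row_col_delta.
  by rewrite -li bl eqxx orbT.
apply/eqP; rewrite mulf_eq0 subr_eq0; apply/orP; left.
(* Either [f] vanishes at both [e i] and [axis l 1], or it is tangent on the axis of [l] and so
   proportional to [u i] there. *)
have [bi|bi] := eqVneq (b i 0) 0.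
  have /eqP -> : ev f (axis l 1) == 0.
    by rewrite fE axis_eval bi bl mulr0 addr0 eqxx orbT.
  have /eqP -> : ev f (e i) == 0 by rewrite fE row_col_delta bi eqxx orbT.
  by rewrite !mul0r.
have tf := tangent_of_pair li bi bl fE.
have := tangent_functionals_proportional hnu rnu li 1 tf (ut li).
by rewrite mulrAC => <-; rewrite mulfK.
Qed.

Let slope j t := ev (u j) (axis j t) / ev (u i) (axis j t).

(** The functional of x_i (x_j - t x_i) involves only [u i] and [u j] and vanishes at both [x] and
    [axis j t], so [u j] and [u i] have the same ratio at these points. *)
Let slopeE j x : j != i -> x 0 i != 0 ->
  ev (u j) x = slope j (x 0 j / x 0 i) * ev (u i) x.
Proof.
move=> ji xi; set t := x 0 j / x 0 i.
pose b := coord j - t *: coord i.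
have bj : b j 0 != 0 by rewrite !mxE !eqxx (negPf ji) mulr0 subr0 oner_eq0.
have [c c0 cE] := pair_functional_combination ji bj.
have bE y : (y *m b) 0 0 = y 0 j - t * y 0 i.
  by rewrite row_colBr row_colZr !row_col_coord.
have sE y : \sum_l c l * ev (u l) y = c i * ev (u i) y + c j * ev (u j) y.
  rewrite (bigD1 i) //= (bigD1 j) //= big1 ?addr0 // => l /andP[li lj].
  by rewrite c0 ?mul0r // !mxE (negPf li) (negPf lj) mulr0 subr0.
have cx : c i * ev (u i) x + c j * ev (u j) x = 0.
  by apply/eqP; rewrite -sE cE bE /t divfK // subrr eqxx orbT.
have ca : c i * ev (u i) (axis j t) + c j * ev (u j) (axis j t) = 0.
  apply/eqP; rewrite -sE cE bE axis_own // axis_base // mulr1 subrr.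
  by rewrite eqxx orbT.
(* Otherwise [c i] is 0 too, as [u i] has no zero on the axis, and the combination vanishes even at
   [axis j (t + 1)], off the pair. *)
have cj : c j != 0.
  apply/eqP => cj; move: ca => /eqP; rewrite cj mul0r addr0 mulf_eq0.
  rewrite (negPf (ui_axis _ ji)) orbF => /eqP ci.
  have := cE (axis j (t + 1)); rewrite sE ci cj !mul0r addr0 eqxx bE.
  rewrite axis_own // axis_base // mulr1 addrAC subrr add0r.
  by rewrite !oner_eq0.
apply: (mulfI cj); rewrite /slope.
have -> : ev (u j) (axis j t) = - c i / c j * ev (u i) (axis j t).
  apply: (mulfI cj); rewrite [RHS]mulrA [in RHS](mulrC (c j)) divfK //.
  by move/eqP: ca; rewrite addrC addr_eq0 -mulNr => /eqP.
rewrite mulfK ?ui_axis // [RHS]mulrA [in RHS](mulrC (c j)) divfK //.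
by move/eqP: cx; rewrite addrC addr_eq0 -mulNr => /eqP.
Qed.

(** If [u i] vanished at [x], so would every [u j]; then [x] is a multiple of [e i], where [u i] is
    nonzero. *)
Let ui_neq0 x : x 0 i != 0 -> ev (u i) x != 0.
Proof.
move=> xi; apply/eqP => ux.
have xj j : j != i -> x 0 j = 0.
  move=> ji; have : ev (u j) x == 0 by rewrite slopeE // ux mulr0.
  by rewrite uE // (negPf xi) => /eqP.
have xE : x = x 0 i *: e i.
  apply/rowP => j; rewrite mxE stdE.
  by have [->|ji] := eqVneq j i; rewrite ?mulr1 // xj // mulr0.
case/eqP: ui_e; apply: (ev_closure hnu (S := [set x])) => [q [qZ _] qx|_ -> //].
have /eqP := qx x erefl; rewrite xE qZ mulf_eq0 sqrf_eq0 (negPf xi).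
by move=> /eqP.
Qed.

Let slope0 j : j != i -> slope j 0 = 0.
Proof. by move=> ji; rewrite /slope axis0 uj_e // mul0r. Qed.

Let slope1 j : j != i -> slope j 1 = 1.
Proof. by move=> ji; rewrite /slope u1 // mulfV // ui_axis. Qed.

(** If [c] were missed, [u j - c *: u i] would be tangent, hence proportional to [u i]; but its
    ratio to [u i] is -c at [e i] and 1 - c at [axis j 1]. *)
Let slope_surj j c : j != i -> exists t, slope j t = c.
Proof.
move=> ji; apply: contrapT => no.
have tg : tangent_on nu i j (u j - c *: u i).
  have ej : e j 0 i = 0 by rewrite stdE eq_sym (negPf ji).
  split=> [|t]; rewrite evB evZ; first by rewrite !u0 // mulr0 subr0.
  rewrite subr_eq0; apply/eqP => ct; apply: no; exists t.
  by rewrite /slope ct mulfK // ui_axis.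
have := tangent_functionals_proportional hnu rnu ji 1 tg (ut ji).
rewrite !evB !evZ (uj_e ji) sub0r (u1 ji) => /eqP.
rewrite mulrBl mulNr mulrAC subr_eq addNr mulf_eq0.
by rewrite (negPf ui_e) (negPf (ui_axis _ ji)).
Qed.

Let point j k s t : 'rV[F]_n.+1 := e i + s *: e j + t *: e k.

Let pointE j k s t : j != i -> k != i -> k != j ->
  [/\ point j k s t 0 i = 1, point j k s t 0 j = s & point j k s t 0 k = t].
Proof.
move=> ji ki kj; rewrite !mxE !eqxx (eq_sym i j) (eq_sym i k) (eq_sym j k).
by rewrite (negPf ji) (negPf ki) (negPf kj); split=> /=; ring.
Qed.

(** The functional of x_i (x_j - r x_k - s x_i), divided by [u i] at the points of its hyperplane
    with affine coordinates r t + s and t, is a relation between slopes with coefficients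
    independent of t. *)
Let combination3 j k r s : j != i -> k != i -> k != j ->
  exists c : F * F * F,
    [/\ s = 0 -> c.2 = 0, c != 0 &
        forall t, c.1.1 * slope j (r * t + s) + c.1.2 * slope k t + c.2 = 0].
Proof.
move=> ji ki kj; pose b := coord j - r *: coord k - s *: coord i.
have jk : j != k by rewrite eq_sym.
have bj : b j 0 != 0.
  by rewrite !mxE !eqxx (negPf ji) (negPf jk) !mulr0 !subr0 oner_eq0.
have [c c0 cE] := pair_functional_combination ji bj.
have bE y : (y *m b) 0 0 = y 0 j - r * y 0 k - s * y 0 i.
  by rewrite !row_colBr !row_colZr !row_col_coord.
have sE y : \sum_l c l * ev (u l) y =
    c j * ev (u j) y + c k * ev (u k) y + c i * ev (u i) y.
  rewrite (bigD1 i) //= (bigD1 j) //= (bigD1 k) ?ki ?kj //=.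
  rewrite big1 => [|l /andP[/andP[li lj] lk]]; first by ring.
  by rewrite c0 ?mul0r // !mxE (negPf li) (negPf lj) (negPf lk) !mulr0 !subr0.
exists (c j, c k, c i); split=> /= [s0||t].
- apply: c0; rewrite !mxE eqxx (eq_sym i j) (eq_sym i k) (negPf ji) (negPf ki).
  by rewrite s0 mul0r mulr0 !subr0.
(* At this point x_j - r x_k - s x_i equals 1, so the functional cannot vanish there. *)
- apply/eqP => -[cj ck ci]; have := cE (point j k (1 + s) 0).
  have [yi yj yk] := pointE (1 + s) 0 ji ki kj.
  rewrite sE cj ck ci !mul0r !addr0 eqxx bE yi yj yk mulr0 subr0 mulr1 addrK.
  by rewrite !oner_eq0.
have [yi yj yk] := pointE (r * t + s) t ji ki kj.
have yi0 : point j k (r * t + s) t 0 i != 0 by rewrite yi oner_eq0.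
apply: (mulIf (ui_neq0 yi0)); rewrite mul0r.
have /eqP : \sum_l c l * ev (u l) (point j k (r * t + s) t) == 0.
  by rewrite cE bE yi yj yk mulr1 addrAC addrK subrr eqxx orbT.
rewrite sE (slopeE ji yi0) (slopeE ki yi0) yi yj yk !divr1 => <-.
by rewrite !mulrDl !mulrA.
Qed.

(** For s = 0 the relation has no constant term, and t = 1 fixes its other coefficients up to a
    common factor. *)
Let slopeM j k r t : j != i -> k != i -> k != j ->
  slope j (r * t) = slope j r * slope k t.
Proof.
move=> ji ki kj; have [[[c d] a] /= [/(_ erefl) -> cd cE]] :=
  combination3 r 0 ji ki kj.
have := cE 1; rewrite mulr1 slope1 // mulr1 !addr0 => c1.
have {c1} dE : d = - (c * slope j r) by rewrite -[LHS]subr0 -c1; ring.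
have c0 : c != 0.
  by apply: contraNneq cd => c0; rewrite dE c0 mul0r oppr0.
apply: (mulfI c0); have := cE t; rewrite !addr0 dE => /eqP.
by rewrite mulNr subr_eq0 => /eqP ->; rewrite -mulrA.
Qed.

Let slope_eq j k : j != i -> k != i -> slope j =1 slope k.
Proof.
move=> ji ki t; have [->//|kj] := eqVneq k j.
by rewrite -[t in LHS]mul1r (slopeM _ _ ji ki kj) slope1 // mul1r.
Qed.

Let slopeMM j r t : j != i -> slope j (r * t) = slope j r * slope j t.
Proof.
move=> ji; have [k ki kj] := exists_third i j n2.
by rewrite (slopeM _ _ ji ki kj) (slope_eq ki ji).
Qed.

Let slope_eq0 j t : j != i -> slope j t = 0 -> t = 0.
Proof.
move=> ji /eqP; rewrite mulf_eq0 invr_eq0 (negPf (ui_axis _ ji)) orbF uE //.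
by rewrite axis_base // axis_own // oner_eq0 => /eqP.
Qed.

Let slopeD j r t : j != i -> slope j (r + t) = slope j r + slope j t.
Proof.
move=> ji; have [k ki kj] := exists_third i j n2.
set m := slope j (- 1).
have mm : m * m = 1 by rewrite -slopeMM // mulrNN mulr1 slope1.
(* In the relation for r = 1, the parameter 0 determines the constant term and -s the coefficient of
   the second slope. *)
have key (s z : F) : s != 0 -> slope j (z + s) = slope j s - m * slope j z.
  move=> s0; have [[[c d] a] /= [_ cd cE]] := combination3 1 s ji ki kj.
  have {}cE (y : F) : c * slope j (y + s) + d * slope j y + a = 0.
    by have := cE y; rewrite mul1r (slope_eq ki ji).
  have := cE 0; rewrite slope0 // mulr0 addr0 add0r => a0.
  have aE : a = - (c * slope j s) by rewrite -[LHS]subr0 -a0; ring.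
  have := cE (- s); rewrite addNr slope0 // -mulN1r slopeMM // -/m aE => d0.
  have dE : d * m = c.
    have sj : slope j s != 0 by apply: contra_neq s0; exact: slope_eq0.
    by apply: (mulIf sj); rewrite -[RHS]add0r -d0; ring.
  have {}dE : d = c * m by rewrite -dE -mulrA mm mulr1.
  have c0 : c != 0.
    by apply: contraNneq cd => c0; rewrite dE aE c0 !mul0r oppr0.
  by apply: (mulfI c0); rewrite -[LHS]subr0 -(cE z) dE aE; ring.
(* Otherwise expanding [slope j (1 + s)] in both orders gives slope 1 at every nonzero s. By
   surjectivity -1 is also such a slope, so 1 = -1. *)
have m1 : m = -1.
  have [//|m1] := eqVneq m (-1).
  have {}m1 : 1 + m != 0 by rewrite addrC addr_eq0.
  have sl1 s : s != 0 -> slope j s = 1.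
    move=> s0; have := key _ 1 s0; rewrite addrC key ?oner_eq0 // slope1 //.
    move=> /eqP; rewrite -subr_eq0 => /eqP E; apply: (mulfI m1).
    by apply/eqP; rewrite -subr_eq0 -oppr_eq0 -[X in _ == X]E; apply/eqP; ring.
  have [s sE] := slope_surj (-1) ji.
  have s0 : s != 0.
    apply/eqP => s0; have := oner_eq0 F.
    by rewrite -oppr_eq0 -sE s0 slope0 // eqxx.
  by rewrite /m sl1 ?oppr_eq0 ?oner_eq0 // -sE sl1.
have [->|t0] := eqVneq t 0; first by rewrite slope0 // !addr0.
by rewrite key // m1 mulN1r opprK addrC.
Qed.

Let slope_bij j : j != i -> bijective (slope j).
Proof.
move=> ji; have [g gK] := choice (fun c => slope_surj c ji).
exists g => // t; apply/eqP; rewrite -subr_eq0; apply/eqP.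
apply: (slope_eq0 ji); rewrite slopeD // -mulN1r slopeMM //.
have m1 : slope j (-1) = -1.
  apply/eqP; rewrite -addr_eq0 -{2}(slope1 ji) -slopeD // addNr.
  by rewrite slope0.
by rewrite m1 gK mulN1r subrr.
Qed.

Lemma axis_coordinates : exists s : F -> F,
  [/\ bijective s, {morph s : x y / x + y}, {morph s : x y / x * y} &
      forall x, x 0 i != 0 -> ev (u i) x != 0 /\
        forall j, ev (u j) x = s (x 0 j / x 0 i) * ev (u i) x].
Proof.
have [k ki _] := exists_third i i n2.
exists (slope k); split=> [|x y|x y|x xi].
- exact: slope_bij.
- exact: slopeD.
- exact: slopeMM.
split=> [|j]; first exact: ui_neq0.
have [->|ji] := eqVneq j i; first by rewrite mulfV // slope1 // mul1r.
by rewrite slopeE // (slope_eq ji ki).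
Qed.

End AxisCoordinates.

(** * Multiplicative bijections of a field *)

Section FieldAutomorphism.
Variables (F : fieldType) (s : F -> F).
Hypotheses (s_bij : bijective s) (sM : {morph s : x y / x * y}).

Lemma bij_morph0 : s 0 = 0.
Proof.
have [t _ tK] := s_bij; have := sM 0 (t 0).
by rewrite mul0r tK mulr0.
Qed.

Lemma bij_morph_eq0 x : (s x == 0) = (x == 0).
Proof. by rewrite -{1}bij_morph0 (inj_eq (bij_inj s_bij)). Qed.

Lemma bij_morph1 : s 1 = 1.
Proof.
have s1 : s 1 != 0 by rewrite bij_morph_eq0 oner_eq0.
by apply: (mulfI s1); rewrite -sM !mulr1.
Qed.

Lemma bij_morphV x : s x^-1 = (s x)^-1.
Proof.
have [->|x0] := eqVneq x 0; first by rewrite invr0 bij_morph0 invr0.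
have sx : s x != 0 by rewrite bij_morph_eq0.
by apply: (mulfI sx); rewrite -sM !mulfV ?bij_morph1.
Qed.

End FieldAutomorphism.

(** * Comparison of the charts *)

Section Coordinates.
Variables (n n' : nat) (F : fieldType) (nu : pg n F -> pg n' F).
Hypotheses (hnu : quadratic_embedding nu) (rnu : regular nu) (n2 : (2 <= n)%N).
Implicit Types (x y : 'rV[F]_n.+1).
Local Notation ev := (ev nu).
Local Notation e := (@std n F).
Local Notation coord j := (delta_mx j 0 : 'cV[F]_n.+1).
Local Notation ones := (const_mx 1 : 'rV[F]_n.+1).

(** The point (1, ..., 1) lies in every chart, so normalizing there puts the functionals of
    different charts on a common scale. *)
Lemma exists_axis_coordinates (i : 'I_n.+1) :
  exists us : ('I_n.+1 -> 'cV[F]_n'.+1) * (F -> F),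
  [/\ [/\ bijective us.2, {morph us.2 : x y / x + y} &
          {morph us.2 : x y / x * y}],
      forall j x, x 0 i = 0 -> ev (us.1 j) x = 0,
      ev (us.1 i) ones = 1 &
      forall x, x 0 i != 0 -> ev (us.1 i) x != 0 /\
        forall j, ev (us.1 j) x = us.2 (x 0 j / x 0 i) * ev (us.1 i) x].
Proof.
have [f f0 ft] := exists_tangent_functional hnu n2 i.
have /choice[g gE] (j : 'I_n.+1) : exists g, j != i ->
    forall x, (ev g x == 0) = (x 0 i == 0) || (x 0 j == 0).
  have [->|ji] := eqVneq j i; first by exists 0.
  have dj : coord j j 0 != 0 by rewrite coordE eqxx oner_eq0.
  have [g gE] := exists_pair_functional hnu ji dj.
  by exists g => _ x; rewrite gE row_col_coord.
(* The factor makes [u j] and [u i] agree at [axis i j 1]. *)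
pose a j := ev f (axis i j 1) / ev (g j) (axis i j 1).
pose u j := if j == i then f else a j *: g j.
have fa j : j != i -> ev f (axis i j 1) != 0 by move=> ji; case: (ft j ji).
have ga j : j != i -> ev (g j) (axis i j 1) != 0.
  by move=> ji; rewrite gE // axis_own // axis_base // oner_eq0.
have [||j x ji|j ji|s [sb sD sM sE]] := axis_coordinates hnu rnu n2 (i := i) (u := u).
- by rewrite /u eqxx.
- by rewrite /u eqxx.
- by rewrite /u (negPf ji) evZ mulf_eq0 gE // mulf_eq0 invr_eq0
    (negPf (fa j ji)) (negPf (ga j ji)).
- by rewrite /u eqxx (negPf ji) evZ /a divfK // ga.
have one_i : ones 0 i != 0 by rewrite mxE oner_eq0.
have [u1 _] := sE _ one_i.
exists (fun j => (ev (u i) ones)^-1 *: u j, s); split=> //= [j x xi||x xi].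
- rewrite evZ (_ : ev (u j) x = 0) ?mulr0 // /u.
  case: ifP => [_|/negbT ji]; first exact: f0.
  by apply/eqP; rewrite evZ mulf_eq0 gE // xi eqxx orbT.
- by rewrite evZ mulVf.
have [ux uj] := sE x xi; split=> [|j].
  by rewrite evZ mulf_neq0 // invr_neq0.
by rewrite !evZ uj; ring.
Qed.

Lemma exists_veronese_coordinates :
  exists (phi : 'I_n.+1 -> 'I_n.+1 -> 'cV[F]_n'.+1) (s : F -> F),
  [/\ bijective s, {morph s : x y / x + y}, {morph s : x y / x * y} &
      forall x, x != 0 -> exists2 a, a != 0 &
        forall i j, ev (phi i j) x = a * (s (x 0 i) * s (x 0 j))].
Proof.
have /choice[us usP] := exists_axis_coordinates.
pose phi i := (us i).1; pose s i := (us i).2.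
have sb i : bijective (s i) by case: (usP i) => -[].
have sD i : {morph s i : x y / x + y} by case: (usP i) => -[].
have sM i : {morph s i : x y / x * y} by case: (usP i) => -[].
have phi0 i j x : x 0 i = 0 -> ev (phi i j) x = 0.
  by case: (usP i) => _ + _ _; apply.
have phi1 i : ev (phi i i) ones = 1 by case: (usP i).
have phi_neq0 i x : x 0 i != 0 -> ev (phi i i) x != 0.
  by case: (usP i) => _ _ _ /(_ x) H /H[].
have phiE i j x : x 0 i != 0 ->
    ev (phi i j) x = s i (x 0 j / x 0 i) * ev (phi i i) x.
  by case: (usP i) => _ _ _ /(_ x) H /H[_ ->].
have phi_ones i j : ev (phi i j) ones = 1.
  by rewrite phiE !mxE ?oner_eq0 // divr1 bij_morph1 // mul1r phi1.
(* Both vanish where x_i x_j = 0 and take the value 1 at (1, ..., 1). *)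
have phiC i j : phi i j = phi j i.
  have [->//|ji] := eqVneq j i.
  have dj : coord j j 0 != 0 by rewrite coordE eqxx oner_eq0.
  apply: (pair_functional_inj hnu ji dj (y := ones)) => [x|x||].
  - rewrite row_col_coord => /eqP; rewrite mulf_eq0 => /orP[/eqP/phi0//|/eqP xj].
    have [xi|xi] := eqVneq (x 0 i) 0; first exact: phi0.
    by rewrite phiE // xj mul0r bij_morph0 // mul0r.
  - rewrite row_col_coord => /eqP; rewrite mulf_eq0 => /orP[/eqP xi|/eqP/phi0//].
    have [xj|xj] := eqVneq (x 0 j) 0; first exact: phi0.
    by rewrite phiE // xi mul0r bij_morph0 // mul0r.
  - by rewrite row_col_coord !mxE mulr1 oner_eq0.
  - by rewrite !phi_ones.
(* At a point with t in a third position [i] and 1 elsewhere, symmetry of [phi] gives [phi j j] and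
   [phi k k] the same value and identifies [s j t] times it with [s i (1 / t)] times the value of
   [phi i i], which does not involve [j]. *)
have s_eq j k : s j =1 s k.
  have [->//|kj] := eqVneq k j; move=> t.
  have [->|t0] := eqVneq t 0; first by rewrite !bij_morph0.
  have [i ij ik] := exists_third j k n2.
  pose x : 'rV[F]_n.+1 := \row_l (if l == i then t else 1).
  have xi : x 0 i = t by rewrite mxE eqxx.
  have xj : x 0 j = 1 by rewrite mxE eq_sym (negPf ij).
  have xk : x 0 k = 1 by rewrite mxE eq_sym (negPf ik).
  have nz l : x 0 l != 0 by rewrite mxE; case: ifP => _ //; rewrite oner_eq0.
  have jk : ev (phi j j) x = ev (phi k k) x.
    have := phiE k j x (nz k); rewrite xj xk divr1 bij_morph1 // mul1r => <-.
    by rewrite (phiC k j) (phiE j k x (nz j)) xj xk divr1 bij_morph1 // mul1r.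
  apply: (mulIf (phi_neq0 j x (nz j))).
  have := phiE j i x (nz j); rewrite xi xj divr1 => <-.
  have := phiE k i x (nz k); rewrite jk xi xk divr1 => <-.
  by rewrite (phiC j) (phiC k) (phiE i j x (nz i)) (phiE i k x (nz i)) xj xk.
exists phi, (s ord0); split=> // x /rV0Pn[m xm].
have sV := bij_morphV (sb ord0) (sM ord0).
have sm : s ord0 (x 0 m) != 0 by rewrite bij_morph_eq0.
(* The factor is forced by the case where both indices are [m]. *)
exists (ev (phi m m) x / (s ord0 (x 0 m)) ^+ 2) => [|i j].
  by rewrite mulf_neq0 ?phi_neq0 // invr_neq0 // expf_neq0.
have [xi|xi] := eqVneq (x 0 i) 0.
  by rewrite phi0 // xi bij_morph0 // mul0r mulr0.
have si : s ord0 (x 0 i) != 0 by rewrite bij_morph_eq0.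
(* The symmetry of [phi m i] links the charts [m] and [i], which yields [phi i i] in terms of
   [phi m m]. *)
have im : s ord0 (x 0 m / x 0 i) * ev (phi i i) x =
          s ord0 (x 0 i / x 0 m) * ev (phi m m) x.
  by have := phiE m i x xm; rewrite phiC phiE // !(s_eq _ ord0).
have ii : ev (phi i i) x =
    s ord0 (x 0 i) ^+ 2 / s ord0 (x 0 m) ^+ 2 * ev (phi m m) x.
  move: im; rewrite !sM !sV => im.
  by apply: (mulfI (mulf_neq0 sm (invr_neq0 si))); rewrite im; field; rewrite si sm.
rewrite phiE // (s_eq i ord0) ii sM sV; field.
by rewrite si sm.
Qed.

End Coordinates.

(** * Independence of the quadratic monomials and construction of the collineation *)

Lemma veronese_independent (F : fieldType) (n : nat)
    (c : 'cV[F]_(veronese_dim n).+1) :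
  (forall x : 'rV[F]_n.+1, (veronese_vec x *m c) 0 0 = 0) -> c = 0.
Proof.
move=> c0; pose p (k : 'I_(veronese_dim n).+1) := nth (ord0, ord0) (upper_pairs n) k.
have p_inj : injective p.
  move=> k l /eqP; rewrite nth_uniq ?uniq_upper_pairs ?size_upper_pairs //.
  by move=> /eqP/val_inj.
have p_le k : ((p k).1 <= (p k).2)%N.
  have : p k \in upper_pairs n by rewrite mem_nth // size_upper_pairs.
  by case: (p k) => i j; rewrite mem_upper_pairs.
have cE (x : 'rV[F]_n.+1) : \sum_k x 0 (p k).1 * x 0 (p k).2 * c k 0 = 0.
  rewrite -[RHS](c0 x) mxE; apply: eq_bigr => k _; rewrite mxE /p.
  by case: nth.
(* At a basis vector the only nonzero monomial is its square. *)
have diag k : (p k).1 = (p k).2 -> c k 0 = 0.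
  move=> pk; have := cE (delta_mx 0 (p k).1); rewrite (bigD1 k) //= big1.
    by rewrite -pk !mxE !eqxx !mul1r addr0.
  move=> l lk; rewrite !mxE !eqxx /=.
  have [p1|] := eqVneq (p l).1; last by rewrite !mul0r.
  have [p2|] := eqVneq (p l).2; last by rewrite mulr0 mul0r.
  case/eqP: lk; apply: p_inj; rewrite [LHS]surjective_pairing p1 p2.
  by rewrite [RHS]surjective_pairing -pk.
apply/colP => k; rewrite [RHS]mxE.
have [/diag//|pk] := eqVneq (p k).1 (p k).2.
have pk_lt : ((p k).1 < (p k).2)%N by rewrite ltn_neqAle p_le andbT.
(* At a sum of two basis vectors only their squares, whose coefficients are 0 by [diag], and their
   product survive. *)
have := cE (delta_mx 0 (p k).1 + delta_mx 0 (p k).2); rewrite (bigD1 k) //= big1.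
  rewrite !mxE !eqxx (negPf pk) eq_sym (negPf pk) /=.
  by rewrite !(addr0, add0r, mul1r).
move=> l lk; have [/diag->|pl] := eqVneq (p l).1 (p l).2; first by rewrite mulr0.
have pl_lt : ((p l).1 < (p l).2)%N by rewrite ltn_neqAle p_le andbT.
rewrite !mxE !eqxx /=.
have [l11|l11] := eqVneq (p l).1 (p k).1.
  have [l22|l22] := eqVneq (p l).2 (p k).2.
    case/eqP: lk; apply: p_inj; rewrite [LHS]surjective_pairing l11 l22.
    by rewrite [RHS]surjective_pairing.
  rewrite -l11 (eq_sym (p l).2) (negPf pl) addr0 mulr0 mul0r //.
have [l12|l12] := eqVneq (p l).1 (p k).2; last by rewrite addr0 !mul0r.
have [l21|l21] := eqVneq (p l).2 (p k).1.
  by move: pl_lt; rewrite l12 l21 ltnNge ltnW.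
by rewrite -l12 (eq_sym (p l).2) (negPf pl) addr0 mulr0 mul0r.
Qed.

Theorem theorem3 (F : fieldType) (n : nat)
    (nu : pg n F -> pg (veronese_dim n) F) :
  (2 <= n)%N -> quadratic_embedding nu -> regular nu ->
  exists kappa : pg (veronese_dim n) F -> pg (veronese_dim n) F,
    is_collineation kappa /\ forall X, nu X = kappa (veronese X).
Proof.
move=> n2 hnu rnu.
have [phi [s [sb sD sM phiE]]] := exists_veronese_coordinates hnu rnu n2.
have [t stK tsK] := sb.
(* Its columns are the functionals [phi i j] in the order of the Veronese coordinates. *)
pose Phi : 'M[F]_((veronese_dim n).+1) := \matrix_(r, k)
  (let: (i, j) := nth (ord0, ord0) (upper_pairs n) k in phi i j r 0).
have repPhi x : x != 0 -> exists2 a, a != 0 &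
    rep nu x *m Phi = a *: map_mx s (veronese_vec x).
  move=> nz_x; have [a a0 aE] := phiE x nz_x; exists a => //.
  apply/rowP => k; rewrite !mxE; case E : (nth _ _ _) => [i j].
  rewrite sM -aE /ev mxE; apply: eq_bigr => r _.
  by rewrite mxE E.
(* Applying [t] to the entries of a column killed by [Phi] gives a linear relation between the
   quadratic monomials. *)
have Phi_unit : Phi \in unitmx.
  rewrite unitmxE unitfE -det_tr; apply/det0P => -[v v0 vP].
  case/eqP: v0; apply: trmx_inj; rewrite trmx0.
  suff /colP c0 : map_mx t v^T = 0.
    apply/colP => k; have := c0 k; rewrite !mxE => /(congr1 s).
    by rewrite tsK bij_morph0.
  apply: veronese_independent => x.
  have [->|nz_x] := eqVneq x 0.
    by rewrite -[0](scale0r 0) veronese_vecZ expr0n scale0r mul0mx mxE.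
  have [a a0 aE] := repPhi x nz_x.
  have /rowP/(_ 0) : rep nu x *m Phi *m v^T = 0.
    by rewrite -mulmxA -[Phi]trmxK -trmx_mul vP trmx0 mulmx0.
  rewrite aE -scalemxAl !mxE => /eqP; rewrite mulf_eq0 (negPf a0) => /eqP sv.
  apply: (can_inj stK); rewrite bij_morph0 // -[RHS]sv.
  rewrite (big_morph s sD (bij_morph0 sb sM)); apply: eq_bigr => k _.
  by rewrite !mxE sM tsK.
(* Inverting [Phi] in [repPhi] shows that [f] takes the Veronese vector of [x] to a multiple of
   [rep nu x]. *)
pose f (w : 'rV[F]_(veronese_dim n).+1) := map_mx s w *m invmx Phi.
pose g (w : 'rV[F]_(veronese_dim n).+1) := map_mx t (w *m Phi).
have fgK : cancel f g.
  by move=> w; rewrite /f /g mulmxKV //; apply/rowP => k; rewrite !mxE stK.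
have gfK : cancel g f.
  move=> w; rewrite /f /g (_ : map_mx s _ = w *m Phi) ?mulmxK //.
  by apply/rowP => k; rewrite [LHS]mxE [in LHS]mxE tsK.
have fZD a b x y : f (a *: x + b *: y) = s a *: f x + s b *: f y.
  rewrite /f !scalemxAl -mulmxDl; congr (_ *m _).
  by apply/rowP => k; rewrite !mxE sD !sM.
have s0 := bij_morph0 sb sM.
exists (semilinear_pg fgK fZD s0); split.
  exact: semilinear_pg_collineation.
move=> X; rewrite (pgE X) veroneseE (semilinear_pgE tsK); apply: val_inj => /=.
set x := vpick _; have nz_x : x != 0 by exact: pg_vpick_neq0.
rewrite nu_vline; have [a a0 aE] := repPhi x nz_x.
have xE : rep nu x = a *: f (veronese_vec x).
  by rewrite /f scalemxAl -aE mulmxK.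
apply: vline_eq; first exact: rep_neq0.
by rewrite xE memvZ ?memv_line.
Qed.
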